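(* Fix an integer $d\ge 2$. There exists $\tau_d<1$ such that for every $\alpha\in\mathcal S_d$, $$B(\alpha;0,N) = \frac{N}{N_d} + \mathcal O(N^{\tau_d}) \quad (N\to\infty).$$
   Context: The Stern sequence $(s(n))_{n\ge0}$ is defined by $s(0)=0$, $s(1)=1$, $s(2n)=s(n)$, $s(2n+1)=s(n)+s(n+1)$. For an integer $d\ge2$, let $S_d(n)=(s(n)\bmod d,\ s(n+1)\bmod d)$, and let $\mathcal S_d=\{(i\bmod d, j\bmod d): \gcd(i,j,d)=1\}$ (a set of pairs of residue classes mod $d$); $N_d=|\mathcal S_d|$. For $\gamma\in\mathcal S_d$ and integers $U_1<U_2$, let $B(\gamma;U_1,U_2)=|\{m: U_1\le m<U_2,\ S_d(m)=\gamma\}|$. *)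

(* Defs.v *)
From HB Require Import structures.
From mathcomp Require Import all_boot all_order all_algebra.

Set Implicit Arguments.
Unset Strict Implicit.
Unset Printing Implicit Defensive.

Import Order.TTheory GRing.Theory Num.Theory.

(* [k] is fuel; the recursive calls are at indices < n, so k = n suffices
   (see [stern_double] and [stern_doubleS]). *)
Fixpoint stern_rec (k n : nat) : nat :=
  if k is k'.+1 then
    if n <= 1 then n
    else if odd n then stern_rec k' n./2 + stern_rec k' n./2.+1
    else stern_rec k' n./2
  else 0.

Definition stern (n : nat) : nat := stern_rec n n.

Lemma stern0 : stern 0 = 0. Proof. by []. Qed.

Lemma stern1 : stern 1 = 1. Proof. by []. Qed.

Lemma stern_rec_fuel (k n : nat) : n <= k -> stern_rec k n = stern n.
Proof.
rewrite /stern.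
suff H N m k1 k2 : m <= N -> m <= k1 -> m <= k2 ->
    stern_rec k1 m = stern_rec k2 m by move=> nk; apply: (H n).
elim: N m k1 k2 => [|N IH] m k1 k2.
  by rewrite leqn0 => /eqP-> _ _; case: k1; case: k2.
move=> mN; case: k1 => [|k1]; first by rewrite leqn0 => /eqP->; case: k2.
case: k2 => [|k2]; first by move=> _; rewrite leqn0 => /eqP->.
move=> m1 m2 /=; case: leqP => // m_gt1.
have h1 : m./2 < m by rewrite ltn_half_double -addnn -{1}[m]addn0 ltn_add2l ltnW.
have le a : m <= a.+1 -> m./2 <= a by move/(leq_trans h1).
case: ifP => odd_m; last by apply: IH; apply: le.
have h2 : m./2.+1 < m.
  rewrite -{2}[m]odd_double_half odd_m add1n ltnS -addnn -{1}[m./2]add0n.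
  by rewrite ltn_add2r half_gt0.
have le2 a : m <= a.+1 -> m./2.+1 <= a by move/(leq_trans h2).
by congr (_ + _); apply: IH; (exact: le || exact: le2).
Qed.

Lemma stern_step (n : nat) : 1 < n ->
  stern n = if odd n then stern n./2 + stern n./2.+1 else stern n./2.
Proof.
case: n => // n n_gt0.
have le : uphalf n <= n by rewrite leq_uphalf_double -addnn leq_addr.
rewrite {1}/stern [LHS]/= ltnNge -ltnS n_gt0 /=.
case: ifP => odd_n; rewrite !stern_rec_fuel //.
rewrite uphalf_half (negPf odd_n) add0n -{2}[n]odd_double_half (negPf odd_n).
rewrite add0n -addnn -{1}[n./2]add0n ltn_add2r half_gt0.
by case: n n_gt0 odd_n {le} => [|[]].
Qed.

Lemma stern_double (n : nat) : stern (2 * n) = stern n.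
Proof.
case: n => // n; rewrite mul2n stern_step; last by rewrite doubleS.
by rewrite odd_double doubleK.
Qed.

Lemma stern_doubleS (n : nat) :
  stern (2 * n + 1) = stern n + stern n.+1.
Proof.
case: n => // n; rewrite mul2n addn1 stern_step; last by rewrite doubleS.
by rewrite /= odd_double /= uphalf_double.
Qed.

(* For d > 1, ['Z_d] is the ring of residue classes mod d and a%:R is the
   class of a; ['Z_0] and ['Z_1] are both Z/2, so results need d > 1. *)
Definition stern_pair (d n : nat) : 'Z_d * 'Z_d :=
  ((stern n)%:R%R, (stern n.+1)%:R%R).

(* gcd(i, j, d) depends only on i and j mod d, so it is read off the canonical
   representatives; [admissibleP] is the form with arbitrary integers. *)
Definition admissible (d : nat) : {set 'Z_d * 'Z_d} :=
  [set p : 'Z_d * 'Z_d | gcdn (gcdn p.1 p.2) d == 1].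

Lemma val_Zp_int (d : nat) (i : int) : 1 < d ->
  Posz ((i%:~R)%R : 'Z_d) = (i %% Posz d)%Z.
Proof.
move=> d_gt1; have d_gt0 : (0 < Posz d)%R by rewrite ltz_nat ltnW.
have r_ge0 : (0 <= (i %% Posz d)%Z)%R by rewrite modz_ge0 // gt_eqF.
have r_lt : (`|(i %% Posz d)%Z| < d)%N by rewrite -ltz_nat gez0_abs ?ltz_pmod.
rewrite [X in X%:~R%R](divz_eq i (Posz d)) -[X in _ = X](gez0_abs r_ge0).
rewrite -{1}(gez0_abs r_ge0) intrD intrM.
have -> : ((Posz d)%:~R = 0 :> 'Z_d)%R by apply: pchar_Zp.
by rewrite mulr0 add0r -pmulrn val_Zp_nat // modn_small.
Qed.

Lemma admissibleP (d : nat) (p : 'Z_d * 'Z_d) : 1 < d ->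
  reflect (exists i j : int, p = (i%:~R, j%:~R)%R /\
             gcdz (gcdz i j) d = 1%Z)
          (p \in admissible d).
Proof.
move=> d_gt1; rewrite inE; apply: (iffP eqP) => [gcd1|[i [j [-> gcd1]]]].
  exists (Posz p.1), (Posz p.2); split.
    by rewrite -!pmulrn !natr_Zp; case: p {gcd1}.
  by congr Posz.
apply/eqP; rewrite -eqz_nat; apply/eqP.
rewrite -[RHS]gcd1 -[LHS]/(gcdz (gcdz (Posz _) (Posz _)) (Posz d)) /= !val_Zp_int //.
by rewrite -gcdzA gcdz_modl gcdzCA gcdz_modl gcdzCA gcdzA.
Qed.

Definition stern_count (d : nat) (gamma : 'Z_d * 'Z_d) (U1 U2 : nat) : nat :=
  #|[set m : 'I_U2 | (U1 <= m) && (stern_pair d m == gamma)]|.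

(* Main.v *)
(** With L0(a,b) = (a,a+b) and L1(a,b) = (a+b,b), which permute the admissible
    pairs, S(2n) = L0 S(n) and S(2n+1) = L1 S(n). Inverses of L0 and L1 are powers
    of them, so by Euclid's algorithm the graph of L0 and L1 on admissible pairs is
    strongly connected; since (0,1) is a fixed point of L0, it is also aperiodic,
    and for some K any two admissible pairs are joined by a path of length K.

    For f on admissible pairs put Pf = f o L0 + f o L1. If f has zero sum then so
    has P^K f, and its sup norm is at most q - 1 times that of f, where q = 2^K.
    As the sum of f(S(m)) over m < qN + r equals that of (P^K f)(S(m)) over m < N
    up to O(q), induction on N bounds it by O(N^tau) with q^tau = q - 1. The
    theorem is the case where f is an indicator function minus its mean. *)

Require Import Defs.
From mathcomp Require Import all_boot all_order all_algebra.
From mathcomp Require Import all_classical all_reals all_analysis.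
From mathcomp Require Import lra zify.

Set Implicit Arguments.
Unset Strict Implicit.
Unset Printing Implicit Defensive.

Import Order.TTheory GRing.Theory Num.Theory.
Import numFieldNormedType.Exports.

Local Open Scope classical_set_scope.
Local Open Scope ring_scope.

(** * The two branch maps on pairs of residues *)

Definition stern_child (d : nat) (c : bool) (p : 'Z_d * 'Z_d) : 'Z_d * 'Z_d :=
  if c then (p.1 + p.2, p.2) else (p.1, p.1 + p.2).

Lemma stern_child_inj (d : nat) (c : bool) : injective (@stern_child d c).
Proof.
pose g (p : 'Z_d * 'Z_d) := if c then (p.1 - p.2, p.2) else (p.1, p.2 - p.1).
apply: (can_inj (g := g)) => -[a b]; rewrite /stern_child /g.
by case: c {g} => /=; rewrite ?addrK // addrC addKr.
Qed.

Lemma stern_pair_double (d n : nat) :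
  stern_pair d n.*2 = stern_child false (stern_pair d n).
Proof.
have := stern_double n; have := stern_doubleS n.
by rewrite mul2n addn1 /stern_pair => -> ->; rewrite natrD.
Qed.

Lemma stern_pair_doubleS (d n : nat) :
  stern_pair d n.*2.+1 = stern_child true (stern_pair d n).
Proof.
have := stern_double n.+1; have := stern_doubleS n.
by rewrite !mul2n doubleS addn1 /stern_pair => -> ->; rewrite natrD.
Qed.

Lemma stern_child_admissible (d : nat) (hd : (2 <= d)%N) (c : bool) p :
  (stern_child c p \in admissible d) = (p \in admissible d).
Proof.
case: d hd p => [|[|d]] // _ [a b]; rewrite !inE; case: c => /=.
  by rewrite gcdnAC gcdn_modl gcdnAC [gcdn (a + b) b]gcdnC gcdnDr [gcdn b a]gcdnC.
by rewrite -gcdnA gcdn_modl gcdnA gcdnDl.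
Qed.

Lemma stern_pair_admissible (d : nat) (hd : (2 <= d)%N) (n : nat) :
  stern_pair d n \in admissible d.
Proof.
elim/ltn_ind: n => -[|n] IH.
  by case: d hd {IH} => [|[|d]] // _; rewrite inE /= gcd0n modn_small ?gcd1n.
rewrite -(odd_double_half n.+1); case: (odd n.+1).
  rewrite add1n stern_pair_doubleS stern_child_admissible // IH //; lia.
rewrite add0n stern_pair_double stern_child_admissible // IH //; lia.
Qed.

(** * Strong connectivity of the graph on admissible pairs *)

Definition stern_edge (d : nat) : rel ('Z_d * 'Z_d) :=
  fun p q => [exists c, q == stern_child c p].

Lemma stern_edgeP (d : nat) (p q : 'Z_d * 'Z_d) :
  reflect (exists c, q = stern_child c p) (stern_edge p q).
Proof. exact: 'exists_eqP. Qed.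

(* On a finite set, the inverse of an injective map is one of its iterates. *)
Lemma connect_stern_child (d : nat) (c : bool) (p : 'Z_d * 'Z_d) :
  connect (@stern_edge d) (stern_child c p) p.
Proof.
have sub : subrel (frel (@stern_child d c)) (connect (@stern_edge d)).
  by move=> x y /eqP <-; apply/connect1/stern_edgeP; exists c.
apply: (connect_sub sub); rewrite fconnect_sym; last exact: stern_child_inj.
exact: fconnect1.
Qed.

(** A path is reversed edge by edge with [connect_stern_child]. Strong connectivity thus reduces to
    joining each admissible pair to one root. *)
Lemma connect_stern_sym (d : nat) : connect_sym (@stern_edge d).
Proof.
suff H p q : connect (@stern_edge d) p q -> connect (@stern_edge d) q p.
  by move=> p q; apply/idP/idP; apply: H.
case/connectP => s + ->; elim: s p => //= r s IH p /andP[/stern_edgeP[c ->]].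
by move=> /IH /connect_trans; apply; apply: connect_stern_child.
Qed.

(** Subtractive Euclidean algorithm: each subtraction undoes one of the two maps, so it is realised
    by a path. *)
Lemma connect_stern_gcd (d a b : nat) :
  connect (@stern_edge d) (a%:R, b%:R) ((gcdn a b)%:R, 0).
Proof.
have [n] := ubnP (a + b)%N; elim: n a b => // n IH a b abn.
have [->|b0] := posnP b; first by rewrite gcdn0.
have [->|a0] := posnP a.
  (* From (0, b) an addition leads to (b, b), and undoing the other map leads to (b, 0). *)
  rewrite gcd0n; apply: (@connect_trans _ _ (b%:R, b%:R)).
    by apply/connect1/stern_edgeP; exists true; rewrite /= add0r.
  have := connect_stern_child false (b%:R : 'Z_d, 0 : 'Z_d).
  by rewrite /= addr0.
have [ab|ba] := leqP a b.
  apply: (@connect_trans _ _ (a%:R, (b - a)%:R)).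
    have := connect_stern_child false (a%:R : 'Z_d, (b - a)%:R).
    by rewrite /= -natrD subnKC.
  have -> : gcdn a b = gcdn a (b - a) by rewrite -{1}(subnKC ab) gcdnDl.
  by apply: IH; lia.
have {}ba := ltnW ba.
apply: (@connect_trans _ _ ((a - b)%:R, b%:R)).
  have := connect_stern_child true ((a - b)%:R : 'Z_d, b%:R).
  by rewrite /= -natrD subnK.
have -> : gcdn a b = gcdn (a - b) b by rewrite -{1}(subnK ba) gcdnC gcdnDr gcdnC.
by apply: IH; lia.
Qed.

Lemma connect_stern_mulrnr (d n : nat) (a b : 'Z_d) :
  connect (@stern_edge d) (a, b) (a, b + a *+ n).
Proof.
elim: n => [|n IH]; first by rewrite mulr0n addr0.
apply: connect_trans IH _; apply/connect1/stern_edgeP; exists false.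
by rewrite /= mulrS addrCA.
Qed.

Lemma connect_stern_mulrnl (d n : nat) (a b : 'Z_d) :
  connect (@stern_edge d) (a, b) (a + b *+ n, b).
Proof.
elim: n => [|n IH]; first by rewrite mulr0n addr0.
apply: connect_trans IH _; apply/connect1/stern_edgeP; exists true.
by rewrite /= mulrSr addrA.
Qed.

Lemma connect_stern_root (d : nat) (hd : (2 <= d)%N) (p : 'Z_d * 'Z_d) :
  p \in admissible d -> connect (@stern_edge d) p (0, 1).
Proof.
case: p => a b; rewrite inE /= => cop.
have := connect_stern_gcd d a b; rewrite !natr_Zp => /connect_trans; apply.
set u : 'Z_d := (gcdn a b)%:R.
have u_unit : u \is a GRing.unit by rewrite unitZpE // coprime_sym.
(* Adding [u] to 0 as many times as the representative of [u^-1] gives 1. The remaining path, from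
   (u, 1) to (0, 1), is the reverse of repeated addition of 1. *)
apply: (@connect_trans _ _ (u, 1)).
  have := connect_stern_mulrnr (u^-1 : 'Z_d) u 0.
  by rewrite add0r -mulr_natr natr_Zp divrr.
have := connect_stern_mulrnl (gcdn a b) (0 : 'Z_d) 1.
by rewrite add0r connect_stern_sym.
Qed.

(** * Counting paths of a given length *)

Arguments stern_child : simpl never.

(** Entry (p, q) of the k-th power of the adjacency matrix: the number of words of length k in the
    two maps that carry p to q. *)
Fixpoint stern_words (d k : nat) (p q : 'Z_d * 'Z_d) : nat :=
  if k is k'.+1 then
    (stern_words k' (stern_child false p) q +
     stern_words k' (stern_child true p) q)%N
  else p == q.

Lemma stern_wordsD_gt0 (d m n : nat) (p q r : 'Z_d * 'Z_d) :
  (0 < stern_words m p q -> 0 < stern_words n q r ->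
   0 < stern_words (m + n) p r)%N.
Proof.
elim: m p => [|m IH] p /=; first by case: eqP => // ->.
rewrite !addn_gt0 => /orP[] w1 w2; apply/orP; [left|right]; exact: IH.
Qed.

(** A path can be shortened to one without repeated vertices. This bounds its length uniformly, as
    needed to pad all paths to one length. *)
Lemma connect_stern_words (d : nat) (p q : 'Z_d * 'Z_d) :
  connect (@stern_edge d) p q ->
  exists2 k, (k < #|{: 'Z_d * 'Z_d}|)%N & (0 < stern_words k p q)%N.
Proof.
case/connectP => s0 /shortenP[s path_s uniq_s _] ->; exists (size s).
  by move/card_uniqP: uniq_s => /= <-; apply: max_card.
elim: s p {uniq_s s0} path_s => [|r s IH] p /=; first by rewrite eqxx.
case/andP => /stern_edgeP[c ->] /IH; rewrite addn_gt0.
by case: c => ->; rewrite ?orbT.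
Qed.

(* Paths are padded to a common length by the loop at the fixed point (0, 1)
   of the even branch. *)
Lemma stern_words_gt0 (d : nat) (hd : (2 <= d)%N) (p q : 'Z_d * 'Z_d) :
  p \in admissible d -> q \in admissible d ->
  (0 < stern_words #|{: 'Z_d * 'Z_d}|.*2 p q)%N.
Proof.
move=> /(connect_stern_root hd) /connect_stern_words[k kT wk].
move=> /(connect_stern_root hd); rewrite connect_stern_sym.
move=> /connect_stern_words[l lT wl].
have loop n : (0 < @stern_words d n (0%R, 1%R) (0%R, 1%R))%N.
  by elim: n => [|n IH] /=; rewrite ?eqxx // /stern_child add0r addn_gt0 IH.
rewrite -addnn; apply: (@stern_wordsD_gt0 _ _ _ _ (0, 1)).
  by rewrite -(subnKC (ltnW kT)); apply: stern_wordsD_gt0 wk (loop _).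
by rewrite -(subnK (ltnW lT)); apply: stern_wordsD_gt0 (loop _) wl.
Qed.

Lemma sum_stern_words (d : nat) (hd : (2 <= d)%N) (k : nat) p :
  p \in admissible d ->
  (\sum_(q in admissible d) stern_words k p q)%N = (2 ^ k)%N.
Proof.
elim: k p => [|k IH] p p_adm /=.
  rewrite (bigD1 p) //= eqxx big1 ?addn0 // => q /andP[_].
  by rewrite eq_sym => /negPf->.
by rewrite big_split /= !IH ?stern_child_admissible // addnn -mul2n expnS.
Qed.

(** * The transfer operator and its contraction on functions with zero sum *)

Definition stern_transfer (d : nat) (R : nmodType)
    (f : 'Z_d * 'Z_d -> R) (p : 'Z_d * 'Z_d) : R :=
  f (stern_child false p) + f (stern_child true p).

Lemma iter_stern_transferE (d : nat) (hd : (2 <= d)%N) (R : pzRingType) (k : nat)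
    (f : 'Z_d * 'Z_d -> R) p : p \in admissible d ->
  iter k (@stern_transfer d R) f p =
  \sum_(q in admissible d) (stern_words k p q)%:R * f q.
Proof.
elim: k p => [|k IH] p p_adm.
  rewrite /= (bigD1 p) //= eqxx mul1r big1 ?addr0 // => q /andP[_].
  by rewrite eq_sym => /negPf->; rewrite mul0r.
rewrite iterS /stern_transfer !IH ?stern_child_admissible // -big_split.
by apply: eq_bigr => q _ /=; rewrite natrD mulrDl.
Qed.

(** Both maps permute the admissible pairs, so each application doubles the sum; in particular a
    zero sum stays zero. *)
Lemma sum_iter_stern_transfer (d : nat) (hd : (2 <= d)%N) (R : nmodType) (k : nat)
    (f : 'Z_d * 'Z_d -> R) :
  \sum_(p in admissible d) iter k (@stern_transfer d R) f p =
  (\sum_(p in admissible d) f p) *+ 2 ^ k.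
Proof.
have child c (g : 'Z_d * 'Z_d -> R) :
    \sum_(p in admissible d) g (stern_child c p) =
    \sum_(p in admissible d) g p.
  rewrite [RHS](reindex_inj (@stern_child_inj d c)).
  by apply: eq_bigl => p; rewrite stern_child_admissible.
elim: k => [|k IH]; first by rewrite expn0 mulr1n.
by rewrite iterS big_split /= !child IH -mulrnDr addnn -mul2n expnS.
Qed.

(* The transition counts are all at least 1; subtracting 1 from each of them
   does not change the image of a function with zero sum. *)
Lemma stern_transfer_contract (d : nat) (hd : (2 <= d)%N) (R : numDomainType)
    (K : nat) (f : 'Z_d * 'Z_d -> R) (b : R) :
  {in admissible d &, forall p q, (0 < stern_words K p q)%N} ->
  \sum_(p in admissible d) f p = 0 ->
  {in admissible d, forall p, `|f p| <= b} ->
  {in admissible d, forall p,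
     `|iter K (@stern_transfer d R) f p| <= ((2 ^ K)%:R - 1) * b}.
Proof.
move=> words_gt0 f0 fb p p_adm; have b0 : 0 <= b := le_trans (normr_ge0 _) (fb p p_adm).
have -> : iter K (@stern_transfer d R) f p =
    \sum_(q in admissible d) ((stern_words K p q)%:R - 1) * f q.
  under eq_bigr do rewrite mulrBl mul1r.
  by rewrite sumrB f0 subr0 iter_stern_transferE.
apply: le_trans (ler_norm_sum _ _ _) _.
apply: (@le_trans _ _
    (\sum_(q in admissible d) ((stern_words K p q)%:R - 1) * b)).
  apply: ler_sum => q q_adm; rewrite normrM.
  have w_ge0 : 0 <= (stern_words K p q)%:R - 1 :> R.
    by rewrite subr_ge0 ler1n words_gt0.
  by rewrite ger0_norm //; apply: ler_wpM2l => //; apply: fb.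
(* The weights add up to [2 ^ K] minus the number of admissible pairs, and there is at least one
   such pair, namely [p]. *)
rewrite -mulr_suml sumrB -natr_sum sum_stern_words // sumr_const.
apply: ler_wpM2r => //; rewrite lerB // ler1n.
by apply/card_gt0P; exists p.
Qed.

(** * Power-saving bound for sums along the Stern pairs *)

Definition stern_sum (d : nat) (R : nmodType) (f : 'Z_d * 'Z_d -> R) (N : nat) : R :=
  \sum_(0 <= m < N) f (stern_pair d m).

Lemma stern_sum_double (d : nat) (R : nmodType) (f : 'Z_d * 'Z_d -> R) (N : nat) :
  stern_sum f N.*2 = stern_sum (stern_transfer f) N.
Proof.
rewrite /stern_sum; elim: N => [|N IH]; first by rewrite !big_nil.
rewrite doubleS !big_nat_recr //= IH stern_pair_double stern_pair_doubleS.
by rewrite -addrA.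
Qed.

Lemma stern_sum_expn2 (d : nat) (R : nmodType) (f : 'Z_d * 'Z_d -> R) (k N : nat) :
  stern_sum f (2 ^ k * N) = stern_sum (iter k (@stern_transfer d R) f) N.
Proof.
elim: k N => [|k IH] N; first by rewrite mul1n.
by rewrite iterS -stern_sum_double -IH expnS -mul2n mulnA [(2 ^ k * 2)%N]mulnC.
Qed.

Lemma stern_sum_tail (d : nat) (hd : (2 <= d)%N) (R : numDomainType)
    (f : 'Z_d * 'Z_d -> R) (b : R) (M r : nat) :
  {in admissible d, forall p, `|f p| <= b} ->
  `|stern_sum f (M + r)| <= `|stern_sum f M| + r%:R * b.
Proof.
move=> fb; elim: r => [|r IH]; first by rewrite addn0 mul0r addr0.
rewrite addnS /stern_sum big_nat_recr //= -natr1 mulrDl mul1r addrA.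
apply: le_trans (ler_normD _ _) _; apply: lerD IH _.
by apply: fb; apply: stern_pair_admissible.
Qed.

(** The constants are uniform in [f] and [b] because the induction passes from [f], [b] to the
    iterated transfer of [f] and [lam * b]. *)
Lemma stern_sum_bound (d : nat) (hd : (2 <= d)%N) (R : realType) :
  exists tau D : R, tau < 1 /\
    forall (f : 'Z_d * 'Z_d -> R) (b : R),
      \sum_(p in admissible d) f p = 0 ->
      {in admissible d, forall p, `|f p| <= b} ->
      forall N, (0 < N)%N -> `|stern_sum f N| <= D * N%:R `^ tau * b.
Proof.
pose K := #|{: 'Z_d * 'Z_d}|.*2; pose q := (2 ^ K)%N.
(* Then [q] is at least 4, so [lam] exceeds 1; this makes [tau] nonnegative and the denominator of
   [E] positive. *)
have K_ge2 : (2 <= K)%N.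
  have : (0 < #|{: 'Z_d * 'Z_d}|)%N by apply/card_gt0P; exists (0, 0).
  by rewrite /K; lia.
have q_ge4 : (4 <= q)%N by rewrite (@leq_exp2l 2 2 K).
have [q_pos q_gt1] : (0 < q)%N /\ (1 < q)%N by split; apply: leq_trans q_ge4.
have q4R : 4 <= q%:R :> R by rewrite ler_nat.
pose lam : R := q%:R - 1; pose tau := ln lam / ln q%:R.
have lam_gt1 : 1 < lam by rewrite /lam; lra.
have q_gt0 : 0 < q%:R :> R by lra.
have lnq_gt0 : 0 < ln q%:R :> R by apply: ln_gt0; lra.
have tau_lt1 : tau < 1.
  by rewrite ltr_pdivrMr // mul1r ltr_ln ?posrE /lam; lra.
have tau_ge0 : 0 <= tau by rewrite divr_ge0 ?ltW // ln_gt0.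
have q_tau : q%:R `^ tau = lam.
  by rewrite /powR gt_eqF // divfK ?gt_eqF // lnK ?posrE //; lra.
pose E : R := q%:R / (lam - 1).
have E_eq : E * (lam - 1) = q%:R by rewrite divfK // subr_eq0 gt_eqF.
have E_ge0 : 0 <= E by rewrite divr_ge0 // subr_ge0 ltW.
exists tau, (q%:R + E); split=> // f b f0 fb N N_gt0.
have b0 (g : 'Z_d * 'Z_d -> R) (c : R) :
    {in admissible d, forall p, `|g p| <= c} -> 0 <= c.
  by move/(_ _ (stern_pair_admissible hd 0)); apply: le_trans.
(* Subtracting [E] makes the induction go through: one step of it multiplies
   [- E] by [lam] and adds a remainder of at most [q = E * (lam - 1)]. *)
suff : `|stern_sum f N| <= ((q%:R + E) * N%:R `^ tau - E) * b.
  move/le_trans; apply; apply: ler_wpM2r; first exact: b0 fb.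
  by rewrite gerBl.
elim/ltn_ind: N f b f0 fb N_gt0 => N IH f b f0 fb N_gt0.
have [Nq|qN] := ltnP N q.
  (* For [N < q] the trivial bound [N * b] suffices, since [N ^ tau >= 1] makes the factor of [b] at
     least [q]. *)
  have := stern_sum_tail hd 0 N fb.
  rewrite {2}/stern_sum big_nil normr0 add0r => /le_trans; apply.
  apply: ler_wpM2r; first exact: b0 fb.
  have : 1 <= N%:R `^ tau.
    have one_tau : 1 `^ tau = 1 :> R by rewrite powR1.
    by rewrite -[leLHS]one_tau; apply: ge0_ler_powR; rewrite ?nnegrE ?ler1n.
  rewrite -subr_ge0 => /(mulr_ge0 (addr_ge0 (ltW q_gt0) E_ge0)).
  have : N%:R <= q%:R :> R by rewrite ler_nat ltnW.
  lra.
have [n n_def] : {n | n = (N %/ q)%N} by exists (N %/ q)%N.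
have n_gt0 : (0 < n)%N by rewrite n_def divn_gt0.
have nN : (n < N)%N by rewrite n_def ltn_Pdiv.
have := stern_sum_tail hd (q * n) (N %% q) fb.
rewrite mulnC n_def -divn_eq -n_def mulnC stern_sum_expn2 => /le_trans; apply.
have := IH n nN (iter K (@stern_transfer d R) f) (lam * b) _ _ n_gt0.
rewrite sum_iter_stern_transfer // f0 mul0rn => /(_ erefl).
have : {in admissible d, forall p,
    `|iter K (@stern_transfer d R) f p| <= lam * b}.
  by apply: stern_transfer_contract => // p r; apply: stern_words_gt0.
move=> contr /(_ contr) bound; apply: le_trans (lerD bound (lexx _)) _.
rewrite mulrA -mulrDl; apply: ler_wpM2r; first exact: b0 fb.
have r_le : (N %% q)%:R <= q%:R :> R by rewrite ler_nat ltnW // ltn_mod.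
(* As [lam] is [q ^ tau], the left side is [(q * n) ^ tau], and [q * n <= N]. *)
have : lam * n%:R `^ tau <= N%:R `^ tau.
  rewrite -q_tau -powRM //; apply: ge0_ler_powR; rewrite ?nnegrE //.
  by rewrite -natrM ler_nat n_def mulnC leq_trunc_div.
move=> /(ler_wpM2l (addr_ge0 (ltW q_gt0) E_ge0)); lra.
Qed.

Theorem theorem4p7 (R : realType) (d : nat) (hd : (2 <= d)%N) :
  exists tau : R, tau < 1 /\
    forall alpha : 'Z_d * 'Z_d, alpha \in admissible d ->
      (fun N : nat => (stern_count alpha 0 N)%:R - N%:R / #|admissible d|%:R : R)
        =O_\oo (fun N : nat => N%:R `^ tau : R).
Proof.
have [tau [D [tau_lt1 bound]]] := stern_sum_bound hd R.
exists tau; split=> // alpha alpha_adm.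
have card_gt0 : (0 < #|admissible d|)%N by apply/card_gt0P; exists alpha.
have card_neq0 : #|admissible d|%:R != 0 :> R by rewrite pnatr_eq0 -lt0n.
pose f p : R := (p == alpha)%:R - #|admissible d|%:R^-1.
have f0 : \sum_(p in admissible d) f p = 0.
  rewrite sumrB sumr_const (bigD1 alpha) //= eqxx big1 => [|p /andP[_ /negPf->//]].
  by rewrite addr0 -[X in _ - X]mulr_natr mulVf // subrr.
have fb : {in admissible d, forall p, `|f p| <= 1}.
  move=> p _; have : #|admissible d|%:R^-1 <= 1 :> R by rewrite invf_le1 ?ler1n ?ltr0n.
  have : 0 <= #|admissible d|%:R^-1 :> R by rewrite invr_ge0.
  by rewrite /f; case: (p == alpha) => /= *; rewrite ler_norml; lra.
have count_sum N :
    (stern_count alpha 0 N)%:R - N%:R / #|admissible d|%:R = stern_sum f N.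
  rewrite /stern_sum sumrB sumr_const_nat subn0 mulr_natl; congr (_ - _).
  rewrite /stern_count -sum1dep_card natr_sum big_mkcond big_mkord.
  by apply: eq_bigr => m _; rewrite /=; case: eqP.
(* The maximum with 1 supplies a positive constant, as the sign of [D] is not known here. *)
apply: (eqO_exP _ _ _).2; exists (Num.max 1 D); first by rewrite lt_max ltr01.
near=> N.
rewrite count_sum [`|N%:R `^ tau|]ger0_norm ?powR_ge0 //.
have N_gt0 : (0 < N)%N by near: N; exists 1%N.
apply: le_trans (bound f 1 f0 fb N N_gt0) _.
by rewrite mulr1 ler_wpM2r ?powR_ge0 // le_max lexx orbT.
Unshelve. all: by end_near.
Qed.
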